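(* Let $K$ be an infinite field, $k\ge1$, $\vec s=(n_1,\dots,n_k)$ a tuple of positive integers, $n=\min(n_1,\dots,n_k)-1$. On $\operatorname{Gr}(\vec s)$ let $\mathcal S_p\subset C_p\otimes\mathcal O_{\operatorname{Gr}(\vec s)}$ be the pullback of the tautological rank-$K'_p(\vec s)$ subbundle on $\operatorname{Gr}(K'_p(\vec s),C_p)$ along the projection $\operatorname{Gr}(\vec s)\to\operatorname{Gr}(K'_p(\vec s),C_p)$, and let $\mathcal S_{p-1}$ be defined similarly in degree $p-1$. For each pair $(p,i)$ with $1\le p\le n$, $0\le i\le p$ and $K'_p(\vec s)>0$, the face map $d_i:C_p\to C_{p-1}$ induces a morphism of vector bundles $$\varphi_{p,i}:\mathcal S_p\longrightarrow\bigl(C_{p-1}\otimes\mathcal O_{\operatorname{Gr}(\vec s)}\bigr)/\mathcal S_{p-1}.$$ Then the incidence variety $\mathbf{Gr}^{\mathrm{simp}}(\vec s)$ is the scheme-theoretic intersection $$\mathbf{Gr}^{\mathrm{simp}}(\vec s)=\bigcap_{p,i}\{\varphi_{p,i}=0\},$$ i.e. the intersection of the rank-$0$ determinantal loci of the bundle maps $\varphi_{p,i}$. In particular, $\mathbf{Gr}^{\mathrm{simp}}(\vec s)$ is a determinantal subvariety of $\operatorname{Gr}(\vec s)$.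
   Context: Notation: $[p]=\{0,\dots,p\}$. Put $M_a(p)=n_a-1-n+p$ (so $M_a(p)\ge p$) and $I_p=\prod_{a=1}^k[M_a(p)]$ for $p\ge 0$. Let $\delta_i^q:[q-1]\to[q]$ be the increasing injection missing $i$ and $\sigma_i^q:[q+1]\to[q]$ the nondecreasing surjection taking the value $i$ twice. $I_\bullet$ is the functor from the simplicial category to sets with $I_\bullet([p])=I_p$, $I_\bullet(\delta_i^p)=\prod_{a}\delta_i^{M_a(p)}:I_{p-1}\to I_p$ and $I_\bullet(\sigma_i^p)=\prod_a\sigma_i^{M_a(p)}:I_{p+1}\to I_p$. $C_\bullet=K[\boldsymbol\Delta^n]$ is the simplicial $K$-vector space with $C_p$ having as basis the nondecreasing maps $\alpha:[p]\to[n]$, with $d_i(\alpha)=\alpha\circ\delta_i^p$; $S_p=\dim C_p=\binom{n+p+1}{p+1}$. For a function $T:I_n\to K$ let $M_{T,p}$ be the matrix with rows indexed by $m\in I_p$, columns by nondecreasing maps $\alpha:[p]\to[n]$, and entries $T(I_\bullet(\alpha)(m))$. The generic rank $R'_p(\vec s)$ is the rank of this matrix over the function field $K(v_u:u\in I_n)$ when $T$ has independent indeterminate entries $T(u)=v_u$; and $K'_p(\vec s)=S_p-R'_p(\vec s)$. $\operatorname{Gr}(r,V)$ is the Grassmannian of $r$-dimensional subspaces of $V$; $\operatorname{Gr}(\vec s)=\prod_{0\le p\le n,\ K'_p(\vec s)>0}\operatorname{Gr}(K'_p(\vec s),C_p)$. The incidence variety $\mathbf{Gr}^{\mathrm{simp}}(\vec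 s)\subset\operatorname{Gr}(\vec s)$ is the closed incidence locus of tuples $(L_p)_p$ satisfying $d_i(L_p)\subseteq L_{p-1}$ for all such pairs $(p,i)$. If $K'_{p-1}(\vec s)=0$, one takes $L_{p-1}=0$ and $\mathcal S_{p-1}=0$. The morphism $\varphi_{p,i}$ is the composite of $\mathcal S_p\subset C_p\otimes\mathcal O$, $d_i\otimes\operatorname{id}$, and the quotient map $C_{p-1}\otimes\mathcal O\to(C_{p-1}\otimes\mathcal O)/\mathcal S_{p-1}$; $\{\varphi_{p,i}=0\}$ is its zero scheme, cut out locally by all matrix entries ($1\times1$ minors). *)

(* Defs.v *)
From HB Require Import structures.
From mathcomp Require Import all_boot all_order all_algebra.
From mathcomp Require Import generic_quotient ring_quotient.
From mathcomp Require Import boolp classical_sets functions cardinality.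
From mathcomp Require Import zify.
From mathcomp Require Import -(notations) mpoly.

Set Implicit Arguments.
Unset Strict Implicit.
Unset Printing Implicit Defensive.

Import GRing.Theory.
Local Open Scope ring_scope.
Local Open Scope quotient_scope.

(* A scheme X over K is represented by its functor of points R |-> X(R) on    *)
(* commutative K-algebras, a subscheme by the corresponding subfunctor, and a *)
(* vector bundle E by the R-modules x^*E, one for each x in X(R), with their  *)
(* base change maps.  comAlgType only contains nonzero algebras: over the     *)
(* zero ring every functor below would have exactly one point.                *)

(** * Submodules, quotient modules and base change *)

Record submod (R : pzRingType) (V : lmodType R) := Submod {
  carrier :> V -> Prop;
  submod0 : carrier 0;
  submodP : forall (a : R) (u v : V),
    carrier u -> carrier v -> carrier (a *: u + v) }.

Lemma submod_eq (R : pzRingType) (V : lmodType R) (L M : submod V) :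
  (forall v, L v <-> M v) -> L = M.
Proof.
case: L M => [L L0 LP] [M M0 MP] /= LM.
have E : L = M by apply/funext => v; apply/propext/LM.
by rewrite {}E in L0 LP *; congr Submod; apply: Prop_irrelevance.
Qed.

Section SubQuot.
Variables (R : pzRingType) (V : lmodType R) (L : submod V).

Lemma submodD u v : L u -> L v -> L (u + v).
Proof. by move=> Lu Lv; rewrite -[u]scale1r; apply: submodP. Qed.

Lemma submodZ a v : L v -> L (a *: v).
Proof. by move=> Lv; rewrite -[_ *: _]addr0; apply: submodP => //; apply: submod0. Qed.

Lemma submod_sum (I : finType) (F : I -> V) :
  (forall i, L (F i)) -> L (\sum_i F i).
Proof.
by move=> LF; elim/big_ind: _ => //; [apply: submod0 | apply: submodD].
Qed.

Definition mem_submod : {pred V} := fun v => `[< L v >].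

Lemma mem_submod_closed : subsemimod_closed mem_submod.
Proof.
split; first split.
- exact/asboolP/submod0.
- by move=> u v /asboolP Lu /asboolP Lv; apply/asboolP/submodD.
- by move=> a v /asboolP Lv; apply/asboolP/submodZ.
Qed.
HB.instance Definition _ :=
  GRing.isSubmodClosed.Build R V mem_submod mem_submod_closed.

Record sub_of := SubOf { sub_val : V; sub_valP : mem_submod sub_val }.
HB.instance Definition _ := [isSub for sub_val].
HB.instance Definition _ := [Choice of sub_of by <:].
HB.instance Definition _ := [SubChoice_isSubLmodule of sub_of by <:].

Definition quo_of := Quotient.quot mem_submod.
HB.instance Definition _ := GRing.Zmodule.on quo_of.

Definition quo_pi (v : V) : quo_of := \pi v.
Definition quo_repr (q : quo_of) : V := repr q.

Lemma quo_reprK : cancel quo_repr quo_pi. Proof. exact: reprK. Qed.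

Lemma quo_piP u v : quo_pi u = quo_pi v <-> L (u - v).
Proof.
split=> [/eqP|/asboolP Luv].
  by rewrite -(Quotient.idealrBE mem_submod) => /asboolP.
by apply/eqP; rewrite -(Quotient.idealrBE mem_submod).
Qed.

Lemma quo_piD u v : quo_pi (u + v) = quo_pi u + quo_pi v.
Proof. exact: (Quotient.pi_add mem_submod). Qed.

Definition quo_scale (a : R) (q : quo_of) : quo_of := quo_pi (a *: quo_repr q).

Lemma quo_piZ a v : quo_pi (a *: v) = quo_scale a (quo_pi v).
Proof.
apply/quo_piP; rewrite -scalerBr; apply/submodZ/quo_piP.
by rewrite quo_reprK.
Qed.

Lemma quo_scaleA a b q : quo_scale a (quo_scale b q) = quo_scale (a * b) q.
Proof. by rewrite -[q]quo_reprK -!quo_piZ scalerA. Qed.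
Lemma quo_scale1 : left_id 1 quo_scale.
Proof. by move=> q; rewrite -[q]quo_reprK -!quo_piZ scale1r. Qed.
Lemma quo_scaleDr : right_distributive quo_scale +%R.
Proof.
move=> a p q; rewrite -[p]quo_reprK -[q]quo_reprK.
set u := quo_repr p; set v := quo_repr q.
by rewrite -quo_piD -!quo_piZ scalerDr quo_piD.
Qed.
Lemma quo_scaleDl q : {morph quo_scale^~ q : a b / a + b}.
Proof.
by move=> a b; rewrite -[q]quo_reprK -!quo_piZ scalerDl quo_piD.
Qed.
HB.instance Definition _ := GRing.Zmodule_isLmodule.Build R quo_of
  quo_scaleA quo_scale1 quo_scaleDr quo_scaleDl.

End SubQuot.

Section ZeroSubmod.
Variables (R : pzRingType) (V : lmodType R).
Let zero_ax (a : R) (u v : V) : u = 0 -> v = 0 -> a *: u + v = 0.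
Proof. by move=> -> ->; rewrite scaler0 addr0. Qed.
Definition zero_submod : submod V := Submod (erefl 0) zero_ax.
End ZeroSubmod.

Definition is_basis (R : pzRingType) (V : lmodType R) (r : nat)
  (b : 'I_r -> V) : Prop :=
  forall v, exists! a : 'rV[R]_r, v = \sum_i a 0 i *: b i.

Definition semilinear (R R' : pzRingType) (g : {rmorphism R -> R'})
  (V : lmodType R) (V' : lmodType R') (h : V -> V') : Prop :=
  {morph h : u v / u + v} /\ forall a v, h (a *: v) = g a *: h v.

Section Schemes.
Variable K : fieldType.
Implicit Types R S T : comAlgType K.

(* The submodule of S^N generated by the image of L, i.e. the image of        *)
(* S (x)_R L in S^N.                                                          *)
Section BaseChange.
Variables (R S : comAlgType K) (g : {lrmorphism R -> S}) (N : nat).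
Variable L : submod 'rV[R]_N.

Definition bc_carrier (w : 'rV[S]_N) : Prop :=
  forall M : submod 'rV[S]_N, (forall v, L v -> M (map_mx g v)) -> M w.
Lemma bc0 : bc_carrier 0. Proof. by move=> M _; apply: submod0. Qed.
Lemma bcP a u v : bc_carrier u -> bc_carrier v -> bc_carrier (a *: u + v).
Proof. by move=> Bu Bv M LM; apply: submodP; [apply: Bu | apply: Bv]. Qed.
Definition bc_submod : submod 'rV[S]_N := Submod bc0 bcP.
End BaseChange.

Section Comap.
Variables (R S : comAlgType K) (g : {lrmorphism R -> S}) (N : nat).
Variable M : submod 'rV[S]_N.
Let comap0 : M (map_mx g (0 : 'rV[R]_N)).
Proof. by rewrite map_mx0; apply: submod0. Qed.
Let comapP a (u v : 'rV[R]_N) :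
  M (map_mx g u) -> M (map_mx g v) -> M (map_mx g (a *: u + v)).
Proof. by move=> Mu Mv; rewrite map_mxD map_mxZ; apply: submodP. Qed.
Definition comap : submod 'rV[R]_N := Submod comap0 comapP.
End Comap.

Lemma bc_mem R S (g : {lrmorphism R -> S}) N (L : submod 'rV[R]_N) v :
  L v -> bc_submod g L (map_mx g v).
Proof. by move=> Lv M; apply. Qed.

Lemma bc_id R N (L : submod 'rV[R]_N) : bc_submod idfun L = L.
Proof.
apply: submod_eq => v; split=> [|Lv M LM]; first by apply=> u Lu; rewrite map_mx_id.
by rewrite -[v](@map_mx_id _ _ _ idfun) //; apply: LM.
Qed.

Lemma bc_comp R S T (g : {lrmorphism R -> S}) (h : {lrmorphism S -> T}) N
  (L : submod 'rV[R]_N) : bc_submod (h \o g) L = bc_submod h (bc_submod g L).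
Proof.
apply: submod_eq => v; split.
  by apply=> u Lu; rewrite map_mx_comp; do 2!apply: bc_mem.
move=> Bv M LM; apply: Bv => u Bu; apply: (Bu (comap h M)) => w Lw /=.
by rewrite -map_mx_comp; apply: LM.
Qed.

Lemma bc_zero R S (g : {lrmorphism R -> S}) N :
  bc_submod g (zero_submod 'rV[R]_N) = zero_submod _.
Proof.
apply: submod_eq => v; split=> [|->]; last exact: submod0.
by apply=> _ -> /=; rewrite map_mx0.
Qed.

(** * Functors of points, closed subschemes *)

Record kfunctor := KFunctor {
  pts :> comAlgType K -> Type;
  pmap : forall R S, {lrmorphism R -> S} -> pts R -> pts S;
  pmap_id : forall R (x : pts R), pmap idfun x = x;
  pmap_comp : forall R S T (g : {lrmorphism R -> S}) (h : {lrmorphism S -> T})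
    (x : pts R), pmap (h \o g) x = pmap h (pmap g x) }.

Section ProdFunctor.
Variables (I : Type) (X : I -> kfunctor).
Let prod_pts R : Type := forall i, X i R.
Let prod_map R S (g : {lrmorphism R -> S}) (x : prod_pts R) : prod_pts S :=
  fun i => pmap g (x i).
Let prod_id R (x : prod_pts R) : prod_map idfun x = x.
Proof. by apply: functional_extensionality_dep => i; apply: pmap_id. Qed.
Let prod_comp R S T (g : {lrmorphism R -> S}) (h : {lrmorphism S -> T})
  (x : prod_pts R) : prod_map (h \o g) x = prod_map h (prod_map g x).
Proof. by apply: functional_extensionality_dep => i; apply: pmap_comp. Qed.
Definition prod_functor : kfunctor := KFunctor prod_id prod_comp.
End ProdFunctor.

Definition subfunctor (X : kfunctor) := forall R, X R -> Prop.

(* Z is a closed subscheme of X: the pullback of Z along every x : Spec R -> X*)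
(* is the closed subscheme V(I) of Spec R for some I.                         *)
Definition closed_subfunctor (X : kfunctor) (Z : subfunctor X) : Prop :=
  forall R (x : X R), exists I : R -> Prop,
    forall S (g : {lrmorphism R -> S}),
      Z S (pmap g x) <-> (forall a, I a -> g a = 0).

(* P holds on each member D(f_j) of a finite covering of Spec R by principal  *)
(* opens.  The open D(f) represents the functor of the g : R -> S with g f    *)
(* invertible, so that, P being stable under base change, "P holds on D(f)"   *)
(* means that P holds for all such g (equivalently, for R -> R_f).            *)
Definition zariski_locally R
  (P : forall S, {lrmorphism R -> S} -> Prop) : Prop :=
  exists (m : nat) (f : 'I_m -> R),
    (exists a : 'I_m -> R, \sum_j a j * f j = 1) /\
    forall j S (g : {lrmorphism R -> S}),
      (exists u, g (f j) * u = 1) -> P S g.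

(** * Vector bundles and determinantal loci *)

Record modfam (X : kfunctor) := ModFam {
  fib :> forall R, X R -> lmodType R;
  fmap : forall R S (g : {lrmorphism R -> S}) (x : X R) (y : X S),
    pmap g x = y -> fib x -> fib y }.

(* The last clause says that fmap identifies fib y with S (x)_R fib x.        *)
Definition quasi_coherent (X : kfunctor) (E : modfam X) : Prop :=
  [/\ forall R S (g : {lrmorphism R -> S}) (x : X R) (y : X S)
        (e : pmap g x = y), semilinear g (fmap (m := E) e),
      forall R (x : X R) (e : pmap idfun x = x) (v : E R x),
        fmap e v = v,
      forall R S T (g : {lrmorphism R -> S}) (h : {lrmorphism S -> T})
        (x : X R) (y : X S) (z : X T) (e1 : pmap g x = y) (e2 : pmap h y = z)
        (e3 : pmap (h \o g) x = z) (v : E R x),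
        fmap e3 v = fmap e2 (fmap e1 v) &
      forall R S (g : {lrmorphism R -> S}) (x : X R) (y : X S)
        (e : pmap g x = y) (N : lmodType S) (h : E R x -> N),
        semilinear g h ->
        exists2 h1 : {linear E S y -> N},
          (forall v, h1 (fmap e v) = h v) &
          forall h2 : {linear E S y -> N},
            (forall v, h2 (fmap e v) = h v) -> h2 =1 h1].

Definition vector_bundle (X : kfunctor) (r : nat) (E : modfam X) : Prop :=
  quasi_coherent E /\
  forall R (x : X R), zariski_locally (fun S (g : {lrmorphism R -> S}) =>
    exists b : 'I_r -> E S (pmap g x), is_basis b).

Definition modhom (X : kfunctor) (E F : modfam X) :=
  forall R (x : X R), E R x -> F R x.

Definition bundle_morphism (X : kfunctor) (E F : modfam X)
  (phi : modhom E F) : Prop :=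
  (forall R (x : X R), linear (phi R x)) /\
  forall R S (g : {lrmorphism R -> S}) (x : X R) (y : X S) (e : pmap g x = y)
    (v : E R x), phi S y (fmap e v) = fmap e (phi R x v).

(* A is the matrix of phi in the bases b and c (acting on row vectors).       *)
Definition is_matrix_of (R : comAlgType K) (E F : lmodType R) (e f : nat)
  (b : 'I_e -> E) (c : 'I_f -> F) (phi : E -> F) (A : 'M[R]_(e, f)) : Prop :=
  [/\ is_basis b, is_basis c & forall i, phi (b i) = \sum_j A i j *: c j].

Section Loci.
Variables (X : kfunctor) (E F : modfam X) (phi : modhom E F).

Definition zero_scheme : subfunctor X := fun R x =>
  zariski_locally (fun S (g : {lrmorphism R -> S}) =>
    exists e f (b : 'I_e -> E S (pmap g x)) (c : 'I_f -> F S (pmap g x)) A,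
      is_matrix_of b c (@phi S (pmap g x)) A /\ forall i j, A i j = 0).

(* The locus rank phi <= r, cut out locally by the (r+1) x (r+1) minors.      *)
Definition determinantal_locus (r : nat) : subfunctor X := fun R x =>
  zariski_locally (fun S (g : {lrmorphism R -> S}) =>
    exists e f (b : 'I_e -> E S (pmap g x)) (c : 'I_f -> F S (pmap g x)) A,
      is_matrix_of b c (@phi S (pmap g x)) A /\
      forall (u : 'I_r.+1 -> 'I_e) (w : 'I_r.+1 -> 'I_f),
        \det (mxsub u w A) = 0).
End Loci.

(* A closed subscheme which is a finite intersection of determinantal loci of *)
(* morphisms of vector bundles.                                               *)
Definition determinantal_subscheme (X : kfunctor) (Z : subfunctor X) : Prop :=
  closed_subfunctor Z /\
  exists (m : nat) (E F : 'I_m -> modfam X) (phi : forall j, modhom (E j) (F j))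
    (e f r : 'I_m -> nat),
    (forall j, [/\ vector_bundle (e j) (E j), vector_bundle (f j) (F j) &
                   bundle_morphism (phi j)]) /\
    forall R (x : X R),
      Z R x <-> forall j, determinantal_locus (phi j) (r j) x.

(** * Subbundles of a trivial bundle *)

Section SubBundle.
Variables (X : kfunctor) (N : nat) (L : forall R, X R -> submod 'rV[R]_N).
Hypothesis L_bc : forall R S (g : {lrmorphism R -> S}) (x : X R),
  L (pmap g x) = bc_submod g (L x).

Lemma subbundle_map_subproof R S (g : {lrmorphism R -> S}) (x : X R) (y : X S)
  (e : pmap g x = y) (v : sub_of (L x)) : mem_submod (L y) (map_mx g (val v)).
Proof. by apply/asboolP; rewrite -e L_bc; apply/bc_mem/asboolP/(valP v). Qed.

Definition subbundle : modfam X :=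
  @ModFam X (fun R x => sub_of (L x)) (fun R S g x y e v =>
    SubOf (subbundle_map_subproof e v)).

Definition quotient_bundle : modfam X :=
  @ModFam X (fun R x => quo_of (L x)) (fun R S g x y e q =>
    quo_pi (L y) (map_mx g (quo_repr q))).
End SubBundle.

(** * Grassmannians *)

(* Rank r subbundles of R^N: direct summands which, locally on Spec R, are    *)
(* spanned by the first r vectors of a basis of R^N.                          *)
Definition is_subbundle R (N r : nat) (L : submod 'rV[R]_N) : Prop :=
  (exists M : submod 'rV[R]_N,
     (forall v, exists u w, [/\ L u, M w & v = u + w]) /\
     (forall v, L v -> M v -> v = 0)) /\
  zariski_locally (fun S (g : {lrmorphism R -> S}) =>
    exists q (b : 'I_(r + q) -> 'rV[S]_N), is_basis b /\
      forall w, bc_submod g L w <->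
        exists a : 'rV[S]_r, w = \sum_i a 0 i *: b (lshift q i)).

Lemma is_subbundle_bc R S (g : {lrmorphism R -> S}) N r
  (L : submod 'rV[R]_N) : is_subbundle r L -> is_subbundle r (bc_submod g L).
Proof.
case=> -[M [LM LM0]] [m [f [[a fa1] Pf]]]; split; last first.
  exists m, (g \o f); split.
    exists (g \o a); rewrite -(rmorph1 g) -fa1 rmorph_sum.
    by apply: eq_bigr => j _; rewrite /= rmorphM.
  move=> j T h hu.
  have [q [b [bb Lb]]] := Pf j T (h \o g) hu.
  by exists q, b; split=> // w; rewrite -bc_comp.
have [eL eLP] : {e : 'I_N -> 'rV[R]_N &
    forall i, L (e i) /\ M (delta_mx 0 i - e i)}.
  apply: (@choice _ _ (fun i u => L u /\ M (delta_mx 0 i - u))) => i.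
  have [u [w [Lu Mw ->]]] := LM (delta_mx 0 i).
  by exists u; split=> //; rewrite addrC addKr.
pose e : 'M[R]_N := \matrix_i eL i.
have vE (v : 'rV[R]_N) : v *m e = \sum_i v 0 i *: eL i.
  by rewrite mulmx_sum_row; apply: eq_bigr => i _; rewrite rowK.
have Le v : L (v *m e).
  by rewrite vE; apply: submod_sum => i; apply/submodZ/(eLP i).1.
have Me v : M (v - v *m e).
  rewrite vE {1}(row_sum_delta v) -sumrB; apply: submod_sum => i.
  by rewrite -scalerBr; apply/submodZ/(eLP i).2.
have subL (H : submod 'rV[R]_N) u v : H u -> H v -> H (u - v).
  by move=> Hu Hv; rewrite addrC -scaleN1r; apply: submodP.
have LK v : L v -> v *m e = v.
  move=> Lv; apply/eqP; rewrite eq_sym -subr_eq0; apply/eqP/LM0 => //.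
  exact: subL.
have MK v : M v -> v *m e = 0.
  move=> Mv; apply: LM0 => //.
  by rewrite -[v *m e]opprK -[X in - X](addKr v) opprD opprK; apply: subL.
pose ge := map_mx g e.
have fix_ax c (u v : 'rV[S]_N) : u *m ge = u -> v *m ge = v ->
    (c *: u + v) *m ge = c *: u + v.
  by move=> eu ev; rewrite mulmxDl -scalemxAl eu ev.
have ker_ax c (u v : 'rV[S]_N) : u *m ge = 0 -> v *m ge = 0 ->
    (c *: u + v) *m ge = 0.
  by move=> eu ev; rewrite mulmxDl -scalemxAl eu ev scaler0 addr0.
pose Fix : submod 'rV[S]_N :=
  @Submod _ _ (fun v => v *m ge = v) (mul0mx _ _) fix_ax.
pose Ker : submod 'rV[S]_N :=
  @Submod _ _ (fun v => v *m ge = 0) (mul0mx _ _) ker_ax.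
have FixP v : bc_submod g L v -> v *m ge = v.
  by move/(_ Fix); apply=> u Lu /=; rewrite -map_mxM LK.
have KerP v : bc_submod g M v -> v *m ge = 0.
  by move/(_ Ker); apply=> u Mu /=; rewrite -map_mxM MK ?map_mx0.
exists (bc_submod g M); split=> [v|v /FixP eLv /KerP eMv]; last first.
  by rewrite -eLv eMv.
exists (v *m ge), (v - v *m ge); split; last by rewrite addrC subrK.
  rewrite mulmx_sum_row; apply: submod_sum => i; apply: submodZ.
  by rewrite -map_row rowK; apply/bc_mem/(eLP i).1.
rewrite {1}(row_sum_delta v) mulmx_sum_row -sumrB.
apply: submod_sum => i; rewrite -scalerBr; apply: submodZ.
rewrite -map_row rowK -(map_delta_mx g) -map_mxB.
exact/bc_mem/(eLP i).2.
Qed.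

Section Grassmannian.
Variables (N r : nat).
Let gr_pts R : Type := {L : submod 'rV[R]_N | is_subbundle r L}.
Let gr_map R S (g : {lrmorphism R -> S}) (L : gr_pts R) : gr_pts S :=
  exist _ (bc_submod g (proj1_sig L)) (is_subbundle_bc g (proj2_sig L)).
Let gr_eq R (L M : gr_pts R) : proj1_sig L = proj1_sig M -> L = M.
Proof. by apply: eq_sig_hprop => ? ? ?; apply: Prop_irrelevance. Qed.
Let gr_id R (L : gr_pts R) : gr_map idfun L = L.
Proof. exact/gr_eq/bc_id. Qed.
Let gr_comp R S T (g : {lrmorphism R -> S}) (h : {lrmorphism S -> T})
  (L : gr_pts R) : gr_map (h \o g) L = gr_map h (gr_map g L).
Proof. exact/gr_eq/bc_comp. Qed.

(* The Grassmannian Gr(r, K^N). *)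
Definition Gr : kfunctor := KFunctor gr_id gr_comp.
End Grassmannian.

End Schemes.

(** * The simplicial set I and the simplicial vector space C *)

(* [p] = {0,...,p} is 'I_p.+1; delta_i^{p+1} : [p] -> [p+1] is lift i, and    *)
(* sigma_i^p : [p+1] -> [p] is degen i.                                       *)
Definition degen p (i : 'I_p.+1) : 'I_p.+2 -> 'I_p.+1 :=
  fun x => inord (unbump i x).

(* alpha + id : [p + c] -> [q + c], extending alpha : [p] -> [q] by the order *)
(* isomorphism of the last c elements.                                        *)
Definition pad c p q (alpha : 'I_p.+1 -> 'I_q.+1) :
    'I_(c + p).+1 -> 'I_(c + q).+1 :=
  fun x => inord (if x <= p then alpha (inord x) : nat else x - p + q)%N.

Section Combinatorics.
Variables (k : nat) (s : 'I_k -> nat).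

(* n = min_a n_a - 1 (for k > 0 the neutral element max_a n_a is irrelevant). *)
Definition dim_n : nat := (\big[minn/(\max_(a < k) s a)%N]_(a < k) s a).-1.

(* M_a(p) = codeg a + p. *)
Definition codeg (a : 'I_k) : nat := s a - 1 - dim_n.

Definition Iset (p : nat) := {dffun forall a : 'I_k, 'I_(codeg a + p).+1}.

(* I(alpha) : I_p -> I_q for any map alpha : [p] -> [q].  By Imap_id,          *)
(* Imap_comp, Imap_delta and Imap_sigma this is the functor determined by     *)
(* I(delta_i^p) = prod_a delta_i^{M_a(p)}, I(sigma_i^p) = prod_a sigma_i^{M_a(p)}.*)
Definition Imap p q (alpha : 'I_p.+1 -> 'I_q.+1) (m : Iset p) : Iset q :=
  [ffun a => pad alpha (m a)].

Lemma pad_val c p q (alpha : 'I_p.+1 -> 'I_q.+1) (x : 'I_(c + p).+1) :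
  pad alpha x = (if x <= p then alpha (inord x) : nat else x - p + q)%N :> nat.
Proof.
rewrite /pad inordK //; have := ltn_ord x; have := ltn_ord (alpha (inord x)).
by case: (leqP x p); lia.
Qed.

Lemma Imap_id p (m : Iset p) : Imap id m = m.
Proof.
apply/ffunP => a; rewrite ffunE; apply: val_inj; rewrite /= pad_val.
by case: (leqP (m a) p) => mp; [rewrite inordK | lia].
Qed.

Lemma Imap_comp p q r (alpha : 'I_p.+1 -> 'I_q.+1) (beta : 'I_q.+1 -> 'I_r.+1)
  (m : Iset p) : Imap (beta \o alpha) m = Imap beta (Imap alpha m).
Proof.
apply/ffunP => a; rewrite !ffunE; apply: val_inj; rewrite /= !pad_val.
case: (leqP (m a) p) => mp; first by rewrite -ltnS ltn_ord inord_val.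
by rewrite ifF; lia.
Qed.

Lemma Imap_delta p (i : 'I_p.+2) (m : Iset p) (a : 'I_k) :
  Imap (lift i) m a = bump i (m a) :> nat.
Proof.
rewrite ffunE pad_val; case: (leqP (m a) p) => mp; first by rewrite /= inordK.
by have := ltn_ord i; rewrite /bump; case: leqP => /=; lia.
Qed.

Lemma Imap_sigma p (i : 'I_p.+1) (m : Iset p.+1) (a : 'I_k) :
  Imap (degen i) m a = unbump i (m a) :> nat.
Proof.
have i_lt := ltn_ord i; rewrite ffunE pad_val.
case: (leqP (m a) p.+1) => mp; rewrite /degen /unbump.
  by rewrite !inordK //; case: (ltnP i (m a)) => /=; lia.
by case: (ltnP i (m a)) => /=; lia.
Qed.

(* The basis of C_p: nondecreasing maps [p] -> [n]. *)
Definition simplex (n p : nat) : finType :=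
  {alpha : {ffun 'I_p.+1 -> 'I_n.+1} |
    [forall x : 'I_p.+1, forall y : 'I_p.+1, (x <= y)%N ==> (alpha x <= alpha y)%N]}.

(* S_p = dim C_p.  The R-module R (x)_K C_p is 'rV[R]_(dimC n p), in          *)
(* coordinates with respect to the basis enum (simplex n p).                  *)
Definition dimC (n p : nat) : nat := #|simplex n p|.

Definition basis_map n p (u : 'I_(dimC n p)) : {ffun 'I_p.+1 -> 'I_n.+1} :=
  val (enum_val u).

(* d_i : C_{p+1} -> C_p, alpha |-> alpha \o delta_i, as a right multiplication.*)
Definition face (R : pzRingType) n p (i : 'I_p.+2) :
    'M[R]_(dimC n p.+1, dimC n p) :=
  \matrix_(u, v) (basis_map v == [ffun x => basis_map u (lift i x)])%:R.

(** * The generic rank *)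

Definition Tmatrix (F : fieldType) (T : Iset dim_n -> F) (p : nat) :
    'M[F]_(#|{: Iset p}|, dimC dim_n p) :=
  \matrix_(m, alpha) T (Imap (basis_map alpha) (enum_val m)).

Variable K : fieldType.

Definition poly_ring : idomainType := mpoly #|{: Iset dim_n}| K.

Definition generic_tensor (u : Iset dim_n) : {fraction poly_ring} :=
  FracField.tofrac (mpolyX K (mnm1 (enum_rank u))).

(* The generic ranks R'_p and K'_p. *)
Definition Rgen (p : nat) : nat := \rank (Tmatrix generic_tensor p).
Definition Kgen (p : nat) : nat := dimC dim_n p - Rgen p.

(** * The ambient product of Grassmannians and the incidence variety *)

Definition degrees := {p : nat | (p <= dim_n)%N && (0 < Kgen p)%N}.

Definition Grs : kfunctor K :=
  prod_functor (fun p : degrees =>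
    Gr K (dimC dim_n (val p)) (Kgen (val p))).

(* L_p, with L_p = 0 when p is not one of the indices of the product.         *)
Definition Lsub (p : nat) R (x : Grs R) : submod 'rV[R]_(dimC dim_n p) :=
  if @idP ((p <= dim_n)%N && (0 < Kgen p)%N) is ReflectT h
  then proj1_sig (x (exist _ p h)) else zero_submod _.

Lemma Lsub_bc p (R S : comAlgType K) (g : {lrmorphism R -> S}) (x : Grs R) :
  Lsub p (pmap g x) = bc_submod g (Lsub p x).
Proof.
by rewrite /Lsub; case: {-}_ / idP => // _; rewrite bc_zero.
Qed.

(* The pullback to Grs of the tautological subbundle of Gr (Kgen p), and the  *)
(* quotient of C_p (x) O by it.                                               *)
Definition taut (p : nat) : modfam Grs := subbundle (@Lsub_bc p).
Definition tautquo (p : nat) : modfam Grs := quotient_bundle (@Lsub p).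

(* The morphism phi_{p+1,i}: degrees are shifted by one here and in Grsimp, so *)
(* that the pairs (p, i) of positive degree p are replaced by (p+1, i).       *)
Definition phi (p : nat) (i : 'I_p.+2) : modhom (taut p.+1) (tautquo p) :=
  fun R x v => quo_pi (Lsub p x) (val v *m face R dim_n i).

(* The incidence locus d_i(L_p) <= L_{p-1}, with the scheme structure given    *)
(* by its functor of points.                                                  *)
Definition Grsimp : subfunctor Grs := fun R x =>
  forall (p : nat) (i : 'I_p.+2), (p.+1 <= dim_n)%N -> (0 < Kgen p.+1)%N ->
    forall v, Lsub p.+1 x v -> Lsub p x (v *m face R dim_n i).

End Combinatorics.

Arguments phi {k} s K {p} i {R} x _.
Arguments Grsimp {k} s K {R} x.

(* Main.v *)
(* Let e be a projector of R^N onto the direct summand L_p.  Membership in    *)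
(* L_p is the linear condition v e = v, which is compatible with base change; *)
(* hence d_i(L_(p+1)) <= L_p is closed, and says that phi_(p+1,i) vanishes.   *)
(* The loci are defined by the matrix entries of phi_(p+1,i) on a Zariski     *)
(* covering, so it remains to see that an element of R which vanishes on      *)
(* every D(f_j) is zero: it is killed by a power of each f_j, as one sees in  *)
(* the localization R_(f_j) = R[X] / (1 - f_j X).                             *)

From Pilot Require Import Defs.
From HB Require Import structures.
From mathcomp Require Import all_boot all_order all_algebra.
From mathcomp Require Import generic_quotient ring_quotient.
From mathcomp Require Import boolp classical_sets functions cardinality.

Set Implicit Arguments.
Unset Strict Implicit.
Unset Printing Implicit Defensive.

Import GRing.Theory.

(** An [R]-point of the product of Grassmannians is a tuple of direct summands [L_p] of free
    modules, and the incidence condition says that each composite L_(p+1) -> C_p -> C_p / L_p is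
    zero. Two things must be reconciled: the incidence condition is imposed over [R] itself, the
    loci only on a covering by principal opens. From [R] to the covering, the inclusion passes to
    every base change ([bc_submod_mul]), and a zero morphism has zero matrix wherever both bundles
    are free. Back from the covering, a projector turns membership in [L_p] into equations between
    elements of [R] ([subbundle_mem_local]), and these can be checked locally by
    [zariski_locally_eq0]. Together this is [phi_zero_scheme]. The same equations show closedness
    ([Grsimp_closed]). The determinantal form follows since 1 x 1 minors are matrix entries, once
    the tautological modules and their quotients are known to be vector bundles
    ([subbundle_vector_bundle], [quotient_vector_bundle]). *)

(** * Transport of an algebra structure along a ring morphism *)

Section AlgebraVia.
Local Open Scope ring_scope.
Variables (K : fieldType) (R : comAlgType K) (Q : comNzRingType).
Variable h : {rmorphism R -> Q}.

(* [Q] with the [K]-algebra structure making [h] a [K]-algebra morphism. *)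
Definition alg_via (_ : {rmorphism R -> Q}) : Type := Q.
Local Notation A := (alg_via h).
HB.instance Definition _ := GRing.ComNzRing.on A.

Definition alg_via_scale (a : K) (x : A) : A := h a%:A * x.

Lemma alg_via_scaleA a b x :
  alg_via_scale a (alg_via_scale b x) = alg_via_scale (a * b) x.
Proof. by rewrite /alg_via_scale mulrA -rmorphM -scalerAl mul1r scalerA. Qed.
Lemma alg_via_scale1 : left_id 1 alg_via_scale.
Proof. by move=> x; rewrite /alg_via_scale scale1r rmorph1 mul1r. Qed.
Lemma alg_via_scaleDr : right_distributive alg_via_scale +%R.
Proof. by move=> a x y; rewrite /alg_via_scale mulrDr. Qed.
Lemma alg_via_scaleDl x : {morph alg_via_scale^~ x : a b / a + b}.
Proof. by move=> a b; rewrite /alg_via_scale scalerDl rmorphD mulrDl. Qed.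
HB.instance Definition _ := GRing.Zmodule_isLmodule.Build K A
  alg_via_scaleA alg_via_scale1 alg_via_scaleDr alg_via_scaleDl.

Lemma alg_via_scaleAl (a : K) (x y : A) : a *: (x * y) = (a *: x) * y.
Proof. exact: mulrA. Qed.
HB.instance Definition _ := GRing.Lmodule_isLalgebra.Build K A alg_via_scaleAl.
HB.instance Definition _ := GRing.Lalgebra_isComAlgebra.Build K A.

Definition to_alg_via (r : R) : A := h r.
Lemma to_alg_via_zmod : zmod_morphism to_alg_via.
Proof. exact: rmorphB. Qed.
Lemma to_alg_via_monoid : monoid_morphism to_alg_via.
Proof. by split; [apply: rmorph1 | apply: rmorphM]. Qed.
Lemma to_alg_via_scalable : scalable to_alg_via.
Proof.
by move=> a r; rewrite /to_alg_via -{1}[r]mul1r scalerAl rmorphM.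
Qed.
HB.instance Definition _ := GRing.isZmodMorphism.Build R A to_alg_via to_alg_via_zmod.
HB.instance Definition _ := GRing.isMonoidMorphism.Build R A to_alg_via to_alg_via_monoid.
HB.instance Definition _ := GRing.isScalable.Build K R A *:%R to_alg_via to_alg_via_scalable.
Definition alg_via_morphism : {lrmorphism R -> A} := to_alg_via.
End AlgebraVia.

(** * The localization R_f as R[X] / (1 - f X) *)

Section Localization.
Local Open Scope quotient_scope.
Local Open Scope ring_scope.
Variables (R : comNzRingType) (f : R).
Hypothesis f_nonnil : forall m, f ^+ m != 0.

Definition inv_ideal : {pred {poly R}} :=
  fun P => `[< exists Q : {poly R}, P = Q * (1 - f *: 'X) >].

(** If r = Q (1 - f X), comparing coefficients forces Q_i = f^i r for all i, and a polynomial has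
    only finitely many nonzero coefficients. *)
Lemma inv_ideal_polyC r : inv_ideal r%:P -> exists m, f ^+ m * r = 0.
Proof.
case/asboolP => Q E.
have coefQ i : Q`_i = f ^+ i * r.
  elim: i => [|i IH].
    have := congr1 (coefp 0) E; rewrite /= coefC eqxx mulrBr mulr1 -scalerAr.
    by rewrite coefB coefZ coefMX /= mulr0 subr0 expr0 mul1r.
  have := congr1 (coefp i.+1) E; rewrite /= coefC /= mulrBr mulr1 -scalerAr.
  rewrite coefB coefZ coefMX /= IH mulrA -exprS => /eqP.
  by rewrite eq_sym subr_eq0 => /eqP.
by exists (size Q); rewrite -coefQ nth_default.
Qed.

Lemma inv_ideal_closed : idealr_closed inv_ideal.
Proof.
split; first by apply/asboolP; exists 0; rewrite mul0r.
  rewrite -[1]/(1%:P); apply/negP => /inv_ideal_polyC[m]; rewrite mulr1.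
  exact/eqP/f_nonnil.
move=> a u v /asboolP[P ->] /asboolP[Q ->]; apply/asboolP; exists (a * P + Q).
by rewrite mulrDl mulrA.
Qed.

(* The ideal is proper because [f] is not nilpotent. *)
HB.instance Definition _ := isIdealr.Build {poly R} inv_ideal inv_ideal_closed.

Definition inv_idealr : idealr {poly R} := inv_ideal.
Definition loc : comNzRingType := {ideal_quot inv_idealr}.
Definition to_loc (r : R) : loc := \pi_{ideal_quot inv_idealr} r%:P.

Lemma to_loc_zmod : zmod_morphism to_loc.
Proof. by move=> u v; rewrite /to_loc polyCB rmorphB. Qed.
Lemma to_loc_monoid : monoid_morphism to_loc.
Proof. by split=> [|u v]; rewrite /to_loc ?rmorph1 // polyCM rmorphM. Qed.
HB.instance Definition _ := GRing.isZmodMorphism.Build R loc to_loc to_loc_zmod.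
HB.instance Definition _ := GRing.isMonoidMorphism.Build R loc to_loc to_loc_monoid.

Lemma to_loc_unit : exists u, to_loc f * u = 1.
Proof.
exists (\pi_{ideal_quot inv_idealr} 'X); rewrite /to_loc -rmorphM -(rmorph1 \pi).
apply/esym/eqP; rewrite -Quotient.idealrBE; apply/asboolP; exists 1.
by rewrite mul1r mul_polyC.
Qed.

Lemma to_loc_eq0 r : to_loc r = 0 -> exists m, f ^+ m * r = 0.
Proof.
rewrite /to_loc -(rmorph0 \pi) => /eqP; rewrite -Quotient.idealrBE subr0.
exact: inv_ideal_polyC.
Qed.
End Localization.

(** * Zariski-local properties *)

Section Zariski.
Local Open Scope ring_scope.
Variable K : fieldType.

(** The radical [J] of the annihilator of [r] is an ideal containing every f_j, because [r] dies in
    R_(f_j). As the f_j generate the unit ideal, [J] contains 1. *)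
Lemma zariski_locally_eq0 (R : comAlgType K) (r : R) :
  zariski_locally (fun S (g : {lrmorphism R -> S}) => g r = 0) -> r = 0.
Proof.
case=> m [f [[a sum1] Pf]].
pose J (t : R) := exists n, t ^+ n * r = 0.
have JD t u : J t -> J u -> J (t + u).
  case=> [n1 E1] [n2 E2]; exists (n1 + n2)%N.
  rewrite exprDn mulr_suml big1 // => i _.
  (* In each binomial term the exponent of [u] is at least [n2] or that of [t] is at least [n1]. *)
  rewrite mulrnAl; case: (leqP n2 i) => ni.
    by rewrite -{2}(subnK ni) exprD -!mulrA E2 !mulr0 mul0rn.
  have n1i : (n1 <= n1 + n2 - i)%N.
    by rewrite -addnBA ?leq_addr // ltnW.
  by rewrite -(subnK n1i) exprD mulrAC -(mulrA _ _ r) E1 mulr0 mul0rn.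
have JM t u : J u -> J (t * u).
  by case=> n E; exists n; rewrite exprMn -mulrA E mulr0.
have Jf j : J (f j).
  (* For nilpotent f_j the localization would be the zero ring, which is not a test algebra, so this
     case is settled directly. *)
  have [[n fn]|fN] := pselect (exists n, f j ^+ n = 0).
    by exists n; rewrite fn mul0r.
  have fnn n : f j ^+ n != 0 by apply/eqP => fn; apply: fN; exists n.
  apply: (@to_loc_eq0 _ _ fnn).
  exact: (Pf j _ (alg_via_morphism (@to_loc _ _ fnn)) (to_loc_unit fnn)).
have [n] : J 1.
  rewrite -sum1; elim/big_ind: _ => [|//|i _]; last exact/JM/Jf.
  by exists 1%N; rewrite expr1 mul0r.
by rewrite expr1n mul1r.
Qed.

(** The products f_i h_j form a common refinement of the two coverings: multiplying the two
    partitions of unity gives one for the products. *)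
Lemma zariski_locally_and (R : comAlgType K)
    (P Q : forall S : comAlgType K, {lrmorphism R -> S} -> Prop) :
  zariski_locally P -> zariski_locally Q ->
  zariski_locally (fun S g => P S g /\ Q S g).
Proof.
case=> m [f [[a sumf] Pf]] [n [h [[b sumh] Qh]]].
pose pr (t : 'I_#|{: 'I_m * 'I_n}|) := enum_val t.
exists #|{: 'I_m * 'I_n}|, (fun t => f (pr t).1 * h (pr t).2); split.
  exists (fun t => a (pr t).1 * b (pr t).2).
  rewrite -(big_enum_val (fun t => a t.1 * b t.2 * (f t.1 * h t.2))).
  rewrite (eq_bigl predT) //.
  rewrite -(pair_bigA _ (fun i j => a i * b j * (f i * h j))) /=.
  rewrite -[RHS]mulr1 -{1}sumf -sumh mulr_suml; apply: eq_bigr => i _.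
  by rewrite mulr_sumr; apply: eq_bigr => j _; rewrite mulrACA.
move=> t S g [u]; rewrite rmorphM => E; split.
  by apply: (Pf (pr t).1); exists (g (h (pr t).2) * u); rewrite mulrA.
apply: (Qh (pr t).2); exists (g (f (pr t).1) * u).
by rewrite mulrCA mulrA.
Qed.

Lemma zariski_locally_impl (R : comAlgType K)
    (P Q : forall S : comAlgType K, {lrmorphism R -> S} -> Prop) :
  (forall S g, P S g -> Q S g) -> zariski_locally P -> zariski_locally Q.
Proof.
move=> PQ [m [f [a Pf]]]; exists m, f; split=> // j S g gu.
exact/PQ/(Pf j).
Qed.

Lemma zariski_locally_always (R : comAlgType K)
    (P : forall S : comAlgType K, {lrmorphism R -> S} -> Prop) :
  (forall S g, P S g) -> zariski_locally P.
Proof.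
move=> PA; exists 1, (fun=> 1); split=> [|? ? ? _]; last exact: PA.
by exists (fun=> 1); rewrite big_ord1 mulr1.
Qed.
End Zariski.

(** * Direct summands of free modules and their base change *)

Section Subbundles.
Local Open Scope ring_scope.
Variable K : fieldType.
Implicit Types R S : comAlgType K.

Lemma submodB R (V : lmodType R) (L : submod V) u v : L u -> L v -> L (u - v).
Proof. by move=> Lu Lv; rewrite addrC -scaleN1r; apply: submodP. Qed.

Definition projector_onto R N (e : 'M[R]_N) (L : submod 'rV[R]_N) : Prop :=
  (forall v, L (v *m e)) /\ (forall v, L v -> v *m e = v).

Lemma projector_ontoP R N (e : 'M[R]_N) L v :
  projector_onto e L -> L v <-> v *m e = v.
Proof. by case=> Le eL; split=> [/eL //|<-]; apply: Le. Qed.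

(** The rows of the projector are the [L]-components of the unit vectors along the chosen
    complement. *)
Lemma subbundle_projector R N r (L : submod 'rV[R]_N) :
  is_subbundle r L -> exists e, projector_onto e L.
Proof.
case=> -[M [LM LM0]] _.
have [eL eLP] : {e : 'I_N -> 'rV[R]_N &
    forall i, L (e i) /\ M (delta_mx 0 i - e i)}.
  apply: (@choice _ _ (fun i u => L u /\ M (delta_mx 0 i - u))) => i.
  have [u [w [Lu Mw ->]]] := LM (delta_mx 0 i).
  by exists u; split=> //; rewrite addrC addKr.
exists (\matrix_i eL i).
have vE (v : 'rV[R]_N) : v *m \matrix_i eL i = \sum_i v 0 i *: eL i.
  by rewrite mulmx_sum_row; apply: eq_bigr => i _; rewrite rowK.
have Le v : L (v *m \matrix_i eL i).
  by rewrite vE; apply: submod_sum => i; apply/submodZ/(eLP i).1.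
split=> // v Lv; apply/esym/eqP; rewrite -subr_eq0; apply/eqP/LM0.
  exact: submodB.
rewrite vE {1}(row_sum_delta v) -sumrB; apply: submod_sum => i.
by rewrite -scalerBr; apply/submodZ/(eLP i).2.
Qed.

Lemma projector_onto_bc R S (g : {lrmorphism R -> S}) N (e : 'M[R]_N) L :
  projector_onto e L -> projector_onto (map_mx g e) (bc_submod g L).
Proof.
case=> Le eL; split=> v.
  rewrite mulmx_sum_row; apply: submod_sum => i; apply: submodZ.
  by rewrite -map_row rowE; apply: bc_mem.
(* The vectors fixed by the base-changed projector form a submodule containing the image of [L],
   hence all of the base change of [L]. *)
have fix_ax c (u w : 'rV[S]_N) : u *m map_mx g e = u -> w *m map_mx g e = w ->
    (c *: u + w) *m map_mx g e = c *: u + w.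
  by move=> eu ew; rewrite mulmxDl -scalemxAl eu ew.
move/(_ (Submod (mul0mx _ _) fix_ax)); apply=> u Lu /=.
by rewrite -map_mxM eL.
Qed.

(** The preimage of [L'] under [A] is a submodule, and the base change is the least one containing
    the image of [L]. *)
Lemma bc_submod_mul R S (g : {lrmorphism R -> S}) M N (A : 'M[S]_(M, N))
    (L : submod 'rV[R]_M) (L' : submod 'rV[S]_N) :
  (forall v, L v -> L' (map_mx g v *m A)) ->
  forall w, bc_submod g L w -> L' (w *m A).
Proof.
move=> LL' w; have cl a (u v : 'rV[S]_M) :
    L' (u *m A) -> L' (v *m A) -> L' ((a *: u + v) *m A).
  by rewrite mulmxDl -scalemxAl; apply: submodP.
have L0 : L' ((0 : 'rV_M) *m A) by rewrite mul0mx; apply: submod0.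
by move/(_ (Submod L0 cl)); apply.
Qed.

(** Covers the convention L_p = 0 in degrees where K'_p = 0. *)
Lemma zero_submod_subbundle R N : is_subbundle 0 (zero_submod 'rV[R]_N).
Proof.
pose full : submod 'rV[R]_N := @Submod _ _ (fun=> True) I (fun _ _ _ _ _ => I).
split.
  exists full; split=> // v; exists 0, v; split=> //; exact/esym/add0r.
apply: zariski_locally_always => S g.
exists N, (fun i => delta_mx 0 i); split=> [v|w].
  exists v; split=> [|a ->]; first exact: row_sum_delta.
  exact/esym/row_sum_delta.
rewrite bc_zero; split=> [->|[a ->]]; last by rewrite big_ord0; apply: submod0.
by exists 0; rewrite big_ord0.
Qed.

(** Spanning gives a left inverse of the basis matrix, and uniqueness of coordinates makes it
    two-sided; over a nonzero commutative ring such a matrix is square. *)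
Lemma basis_size R N n (b : 'I_n -> 'rV[R]_N) : is_basis b -> n = N.
Proof.
move=> bb; pose B := \matrix_i b i.
have bE (a : 'rV[R]_n) : \sum_i a 0 i *: b i = a *m B.
  by rewrite mulmx_sum_row; apply: eq_bigr => i _; rewrite rowK.
have [C CB] : exists C : 'M_(N, n), C *m B = 1%:M.
  have [c cP] : {c : 'I_N -> 'rV_n & forall i, c i *m B = delta_mx 0 i}.
    apply: (@choice _ _ (fun i c => c *m B = delta_mx 0 i)) => i.
    by have [c [E _]] := bb (delta_mx 0 i); exists c; rewrite -bE.
  exists (\matrix_i c i); apply/row_matrixP => i.
  by rewrite row_mul rowK cP row1.
have BC : B *m C = 1%:M.
  apply/row_matrixP => i; rewrite row_mul rowK row1.
  have [c [_ uc]] := bb (b i).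
  rewrite -(uc (b i *m C)) ?bE -?mulmxA ?CB ?mulmx1 //.
  by apply: uc; rewrite bE -rowE rowK.
by apply/eqP; rewrite eqn_leq (mulmx1_min BC) (mulmx1_min CB).
Qed.

Lemma quo_pi_linear R (V : lmodType R) (M : submod V) : linear (quo_pi M).
Proof. by move=> a u v; rewrite quo_piD quo_piZ. Qed.
HB.instance Definition _ R (V : lmodType R) (M : submod V) :=
  GRing.isLinear.Build R V (quo_of M) _ (quo_pi M) (@quo_pi_linear R V M).

Lemma quo_pi_eq0 R (V : lmodType R) (M : submod V) v : quo_pi M v = 0 <-> M v.
Proof. by rewrite -(linear0 (quo_pi M)) quo_piP subr0. Qed.

(** * The subbundle and the quotient bundle of a compatible family of summands *)

Section Family.
Variables (X : kfunctor K) (N r : nat).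
Variable L : forall R, X R -> submod 'rV[R]_N.
Hypothesis L_bc : forall R S (g : {lrmorphism R -> S}) (x : X R),
  L (Defs.pmap g x) = bc_submod g (L x).
Hypothesis L_sub : forall R (x : X R), is_subbundle r (L x).

Lemma subbundle_quasi_coherent : quasi_coherent (subbundle L_bc).
Proof.
split.
- move=> R S g x y e; split=> [u v|a v]; apply: val_inj => /=.
    by rewrite -map_mxD.
  by rewrite -map_mxZ.
- by move=> R x e v; apply: val_inj; rewrite /= map_mx_id.
- by move=> R S T g h x y z e1 e2 e3 v; apply: val_inj; rewrite /= map_mx_comp.
move=> R S g x y e M h [hD hZ].
have [p pL] := subbundle_projector (L_sub x).
have Lp i : mem_submod (L x) (row i p).
  by apply/asboolP; rewrite rowE; apply: pL.1.
pose b i : sub_of (L x) := SubOf (Lp i).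
(* The rows of the projector generate [L x], and the coordinates of [v] in the ambient space serve
   as coefficients; this gives a formula for the extension of [h] with no choice involved. *)
have subE (v : sub_of (L x)) : v = \sum_i val v 0 i *: b i.
  apply: val_inj; rewrite raddf_sum /=.
  have /asboolP/pL.2 {1}<- := valP v.
  by rewrite mulmx_sum_row; apply: eq_bigr.
have h0 : h 0 = 0 by rewrite -(scale0r 0) hZ rmorph0 scale0r.
have hsum (I : finType) (F : I -> sub_of (L x)) : h (\sum_i F i) = \sum_i h (F i).
  exact: (big_morph h hD h0).
pose h1 (w : sub_of (L y)) : M := \sum_i val w 0 i *: h (b i).
have h1_lin : linear h1.
  move=> a u v; rewrite /h1 scaler_sumr -big_split; apply: eq_bigr => i _ /=.
  by rewrite !mxE scalerDl scalerA.
pose h1L : {linear sub_of (L y) -> M} := HB.pack h1 (GRing.isLinear.Build _ _ _ _ h1 h1_lin).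
exists h1L => [v|h2 h2P w].
  have -> : h v = \sum_i g (val v 0 i) *: h (b i).
    by rewrite {1}(subE v) hsum; apply: eq_bigr => i _; rewrite hZ.
  by apply: eq_bigr => i _; rewrite mxE.
have wE : w = \sum_i val w 0 i *: fmap (m := subbundle L_bc) e (b i).
  apply: val_inj; rewrite raddf_sum /=.
  have := valP w; move/asboolP; rewrite -{1}e L_bc.
  move/(projector_ontoP _ (projector_onto_bc g pL)) => {1}<-.
  by rewrite mulmx_sum_row; apply: eq_bigr => i _; rewrite map_row.
rewrite {1}wE linear_sum; apply: eq_bigr => i _.
by rewrite linearZ h2P.
Qed.

Lemma subbundle_vector_bundle : vector_bundle r (subbundle L_bc).
Proof.
split=> [|R x]; first exact: subbundle_quasi_coherent.
apply: zariski_locally_impl (L_sub x).2 => S g [q [b [bb]]]; rewrite -L_bc => Lb.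
have memb i : mem_submod (L (Defs.pmap g x)) (b (lshift q i)).
  apply/asboolP/Lb; exists (delta_mx 0 i).
  rewrite (bigD1 i) //= mxE !eqxx scale1r big1 ?addr0 // => j ji.
  by rewrite mxE (negPf ji) andbF scale0r.
exists (fun i => SubOf (memb i)) => v.
have /asboolP/Lb[a va] := valP v.
exists a; split=> [|a' va'].
  by apply: val_inj; rewrite raddf_sum; apply: va.
have [c [_ uc]] := bb (val v).
(* Padding by zeros reduces uniqueness to that for the ambient basis. *)
have sumb (d : 'rV[S]_r) :
    \sum_i row_mx d (0 : 'rV_q) 0 i *: b i = \sum_i d 0 i *: b (lshift q i).
  rewrite big_split_ord /= [X in _ + X]big1 ?addr0.
    by apply: eq_bigr => i _; rewrite row_mxEl.
  by move=> i _; rewrite row_mxEr mxE scale0r.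
have ca := uc (row_mx a 0); have ca' := uc (row_mx a' 0).
rewrite !sumb in ca ca'.
have E : row_mx a 0 = row_mx a' 0 :> 'rV_(r + q).
  rewrite -ca // -ca' //; have := congr1 val va'.
  by rewrite raddf_sum.
by have [] := eq_row_mx E.
Qed.

Lemma quotient_fmapE R S (g : {lrmorphism R -> S}) (x : X R) (y : X S)
    (e : Defs.pmap g x = y) (v : 'rV[R]_N) :
  fmap (m := quotient_bundle L) e (quo_pi (L x) v) = quo_pi (L y) (map_mx g v).
Proof.
apply/quo_piP; rewrite -map_mxB -e L_bc; apply: bc_mem.
by apply/quo_piP; rewrite quo_reprK.
Qed.

(** The extension is first defined on S^N by its values on unit vectors. Its kernel is a submodule
    containing the image of [L x], hence [L y], so it descends to the quotient. *)
Lemma quotient_bundle_quasi_coherent : quasi_coherent (quotient_bundle L).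
Proof.
split.
- move=> R S g x y e; split=> [u v|a v].
    rewrite -[u]quo_reprK -[v]quo_reprK -linearD !quotient_fmapE.
    by rewrite map_mxD linearD.
  by rewrite -[v]quo_reprK -linearZ !quotient_fmapE map_mxZ linearZ.
- by move=> R x e v; rewrite -[v]quo_reprK quotient_fmapE map_mx_id.
- move=> R S T g h x y z e1 e2 e3 v.
  by rewrite -[v]quo_reprK !quotient_fmapE map_mx_comp.
move=> R S g x y e M h [hD hZ].
have h0 : h 0 = 0 by rewrite -(scale0r 0) hZ rmorph0 scale0r.
have hsum (I : finType) (F : I -> quo_of (L x)) : h (\sum_i F i) = \sum_i h (F i).
  exact: (big_morph h hD h0).
pose H (w : 'rV[S]_N) : M := \sum_i w 0 i *: h (quo_pi (L x) (delta_mx 0 i)).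
have H_lin : linear H.
  move=> a u v; rewrite /H scaler_sumr -big_split; apply: eq_bigr => i _ /=.
  by rewrite !mxE scalerDl scalerA.
pose HL : {linear 'rV[S]_N -> M} := HB.pack H (GRing.isLinear.Build _ _ _ _ H H_lin).
have HE v : H (map_mx g v) = h (quo_pi (L x) v).
  rewrite {2}(row_sum_delta v) linear_sum hsum; apply: eq_bigr => i _.
  by rewrite linearZ hZ mxE.
have H_ker w : L y w -> H w = 0.
  have ker_ax a u v : H u = 0 -> H v = 0 -> H (a *: u + v) = 0.
    by move=> Hu Hv; rewrite H_lin Hu Hv scaler0 addr0.
  rewrite -e L_bc => /(_ (Submod (linear0 HL) ker_ax)); apply=> v Lv /=.
  by rewrite HE (quo_pi_eq0 (L x) v).2.
pose h1 (w : quo_of (L y)) : M := H (quo_repr w).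
have h1E w : h1 (quo_pi (L y) w) = H w.
  apply/eqP; rewrite -subr_eq0 -(linearB HL); apply/eqP/H_ker.
  by apply/quo_piP; rewrite quo_reprK.
have h1_lin : linear h1.
  move=> a u v; rewrite -[u]quo_reprK -[v]quo_reprK.
  by rewrite -(linearP (quo_pi (L y))) !h1E H_lin.
pose h1L : {linear quo_of (L y) -> M} := HB.pack h1 (GRing.isLinear.Build _ _ _ _ h1 h1_lin).
exists h1L => [v|h2 h2P w].
  by rewrite -[v]quo_reprK quotient_fmapE [LHS]h1E HE.
rewrite -[w]quo_reprK [RHS]h1E {1}(row_sum_delta (quo_repr w)).
rewrite linear_sum linear_sum; apply: eq_bigr => i _.
rewrite linearZ linearZ -h2P quotient_fmapE; congr (_ *: h2 (quo_pi _ _)).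
exact/esym/map_delta_mx.
Qed.

(** Locally the last [q] vectors of an adapted basis give a basis of the quotient. *)
Lemma quotient_vector_bundle : vector_bundle (N - r) (quotient_bundle L).
Proof.
split=> [|R x]; first exact: quotient_bundle_quasi_coherent.
apply: zariski_locally_impl (L_sub x).2 => S g [q [b [bb]]]; rewrite -L_bc => Lb.
have -> : (N - r)%N = q by rewrite -(basis_size bb) addKn.
pose Q := quo_pi (L (Defs.pmap g x)).
exists (fun i => Q (b (rshift r i))) => w.
have Qb i : Q (b (lshift q i)) = 0.
  apply/quo_pi_eq0/Lb; exists (delta_mx 0 i).
  rewrite (bigD1 i) //= mxE !eqxx scale1r big1 ?addr0 // => j ji.
  by rewrite mxE (negPf ji) andbF scale0r.
have [c [cE uc]] := bb (quo_repr w).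
exists (rsubmx c); split.
  rewrite -[w]quo_reprK cE linear_sum big_split_ord /= [X in X + _]big1 ?add0r.
    by apply: eq_bigr => i _; rewrite linearZ mxE.
  move=> i _; rewrite linearZ -[RHS](scaler0 _ (c 0 (lshift q i))).
  exact: (congr1 _ (Qb i)).
move=> a wa.
have : L (Defs.pmap g x) (quo_repr w - \sum_i a 0 i *: b (rshift r i)).
  apply/quo_pi_eq0; rewrite linearB /= quo_reprK linear_sum {1}wa -sumrB big1 // => i _.
  by rewrite linearZ subrr.
move=> /Lb[a' E].
rewrite (uc (row_mx a' a)) ?row_mxKr // big_split_ord /=.
move/eqP: E; rewrite subr_eq => /eqP ->; congr (_ + _); apply: eq_bigr => i _.
  by rewrite row_mxEl.
by rewrite row_mxEr.
Qed.

Lemma subbundle_mem_local R (x : X R) w :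
  zariski_locally (fun S (g : {lrmorphism R -> S}) =>
    L (Defs.pmap g x) (map_mx g w)) -> L x w.
Proof.
have [p pL] := subbundle_projector (L_sub x).
move=> Lw; apply/(projector_ontoP _ pL)/rowP => i; apply/eqP.
rewrite -subr_eq0; apply/eqP/zariski_locally_eq0.
apply: zariski_locally_impl Lw => S g; rewrite L_bc.
move/(projector_ontoP _ (projector_onto_bc g pL))/rowP/(_ i).
by rewrite -map_mxM !mxE rmorphB => ->; rewrite subrr.
Qed.
End Family.

(** * Zero schemes and determinantal loci of a bundle morphism *)

Section MorphismLoci.
Variables (X : kfunctor K) (E F : modfam X) (phi : modhom E F).

Lemma zero_scheme_vanishing (e f : nat) R (x : X R) :
  vector_bundle e E -> vector_bundle f F -> bundle_morphism phi ->
  zero_scheme phi x <-> zariski_locally (fun S (g : {lrmorphism R -> S}) =>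
    forall v, @phi S (Defs.pmap g x) v = 0).
Proof.
move=> [_ /(_ R x) Eb] [_ /(_ R x) Fb] [phi_lin _]; split.
  apply: zariski_locally_impl => S g [e' [f' [b [c [A [[bb _ phib] A0]]]]]] v.
  pose phiL : {linear E S (Defs.pmap g x) -> F S (Defs.pmap g x)} :=
    HB.pack (@phi S (Defs.pmap g x))
      (GRing.isLinear.Build _ _ _ _ _ (phi_lin S (Defs.pmap g x))).
  change (phiL v = 0); have [a [-> _]] := bb v.
  rewrite linear_sum big1 // => i _.
  rewrite linearZ /= phib big1 ?scaler0 // => j _.
  by rewrite A0 scale0r.
(* Refine the covering so that both bundles are also free; the matrix is then 0 in any bases. *)
move=> phi0; have := zariski_locally_and phi0 (zariski_locally_and Eb Fb).
apply: zariski_locally_impl => S g [{}phi0 [[b bb] [c bc]]].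
exists e, f, b, c, 0; split; last by move=> i j; rewrite mxE.
by split=> // i; rewrite phi0 big1 // => j _; rewrite mxE scale0r.
Qed.

Lemma determinantal_locus0 R (x : X R) :
  determinantal_locus phi 0 x <-> zero_scheme phi x.
Proof.
split; apply: zariski_locally_impl => S g [e [f [b [c [A [Ab A0]]]]]];
  exists e, f, b, c, A; split=> //.
  by move=> i j; have := A0 (fun=> i) (fun=> j); rewrite det_mx11 mxE.
by move=> u w; rewrite det_mx11 mxE.
Qed.
End MorphismLoci.
End Subbundles.

(** * The incidence variety as a determinantal subscheme *)

Section Incidence.
Local Open Scope ring_scope.
Variables (K : fieldType) (k : nat) (s : 'I_k -> nat).
Implicit Types R S : comAlgType K.

Lemma Lsub_is_subbundle p R (x : Grs s K R) :
  (p <= dim_n s)%N -> is_subbundle (Kgen s K p) (Lsub p x).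
Proof.
move=> pn; rewrite /Lsub; case: {-}_ / idP => [h|]; first exact: proj2_sig.
rewrite pn lt0n => /negP; rewrite negbK => /eqP ->.
exact: zero_submod_subbundle.
Qed.

Lemma map_face R S (g : {lrmorphism R -> S}) n p (i : 'I_p.+2) :
  map_mx g (face R n i) = face S n i.
Proof. by apply/matrixP => u v; rewrite !mxE rmorph_nat. Qed.

Section Phi.
Variables (p : nat) (i : 'I_p.+2).
Hypotheses (pn : (p.+1 <= dim_n s)%N).

Lemma taut_vector_bundle : vector_bundle (Kgen s K p.+1) (taut s K p.+1).
Proof. by apply: subbundle_vector_bundle => R x; apply: Lsub_is_subbundle. Qed.

Lemma tautquo_vector_bundle :
  vector_bundle (dimC (dim_n s) p - Kgen s K p) (tautquo s K p).
Proof.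
apply: quotient_vector_bundle => [R S g x | R x]; first exact: Lsub_bc.
exact/Lsub_is_subbundle/ltnW.
Qed.

Lemma phi_bundle_morphism : bundle_morphism (@phi k s K p i).
Proof.
split=> [R x a u v | R S g x y e v]; rewrite /phi.
  by rewrite [val _]/= mulmxDl -scalemxAl linearP.
rewrite (quotient_fmapE (@Lsub_bc _ s K p)) map_mxM map_face.
by [].
Qed.

Lemma phi_zero_scheme R (x : Grs s K R) :
  zero_scheme (@phi k s K p i) x <->
  forall v, Lsub p.+1 x v -> Lsub p x (v *m face R (dim_n s) i).
Proof.
rewrite (zero_scheme_vanishing x taut_vector_bundle tautquo_vector_bundle
  phi_bundle_morphism).
split=> [phi0 v Lv | inc].
  apply: (subbundle_mem_local (@Lsub_bc _ s K p)).
    by move=> S y; apply/Lsub_is_subbundle/ltnW.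
  apply: zariski_locally_impl phi0 => S g phi0.
  rewrite map_mxM map_face.
  have Lgv : mem_submod (Lsub p.+1 (Defs.pmap g x)) (map_mx g v).
    by apply/asboolP; rewrite Lsub_bc; apply: bc_mem.
  exact/quo_pi_eq0/(phi0 (SubOf Lgv)).
(* The inclusion over [R] persists over every [S], so the trivial covering suffices. *)
apply: zariski_locally_always => S g v; apply/quo_pi_eq0.
have /asboolP := valP v; move: (val v) => w; rewrite !Lsub_bc.
move: w; apply: bc_submod_mul => u Lu.
by rewrite -(map_face g) -map_mxM; apply/bc_mem/inc.
Qed.
End Phi.

Lemma Grsimp_zero_scheme R (x : Grs s K R) :
  Grsimp s K x <-> forall (p : nat) (i : 'I_p.+2),
    (p.+1 <= dim_n s)%N -> (0 < Kgen s K p.+1)%N -> zero_scheme (@phi k s K p i) x.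
Proof.
by split=> H p i pn Kp; move: (H p i pn Kp); rewrite phi_zero_scheme.
Qed.

Lemma Grsimp_determinantal_locus R (x : Grs s K R) :
  Grsimp s K x <-> forall (p : nat) (i : 'I_p.+2),
    (p.+1 <= dim_n s)%N -> (0 < Kgen s K p.+1)%N ->
    determinantal_locus (@phi k s K p i) 0 x.
Proof.
rewrite Grsimp_zero_scheme.
by split=> H p i pn Kp; apply/determinantal_locus0/H.
Qed.

Lemma Grsimp_closed : closed_subfunctor (@Grsimp k s K).
Proof.
move=> R x.
(* The equations are the coordinates of w e - w, where w = d_i(v) and [e] projects onto L_p; they
   vanish exactly when [w] lies in L_p. *)
exists (fun a => exists (p : nat) (i : 'I_p.+2) v l e,
  [/\ (p.+1 <= dim_n s)%N, (0 < Kgen s K p.+1)%N, Lsub p.+1 x v,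
      projector_onto e (Lsub p x) &
      a = (v *m face R (dim_n s) i *m e - v *m face R (dim_n s) i) 0 l]).
move=> S g; split=> [inc _ [p [i [v [l [e [pn Kp Lv eL ->]]]]]] | I0 p i pn Kp].
  have Lgv : bc_submod g (Lsub p.+1 x) (map_mx g v) by apply: bc_mem.
  have := inc p i pn Kp (map_mx g v).
  rewrite !Lsub_bc (projector_ontoP _ (projector_onto_bc g eL)).
  move/(_ Lgv)/rowP/(_ l).
  by rewrite -(map_face g) -!map_mxM !mxE rmorphB => ->; rewrite subrr.
have [e eL] := subbundle_projector (Lsub_is_subbundle x (ltnW pn)).
rewrite !Lsub_bc; apply: bc_submod_mul => v Lv.
apply/(projector_ontoP _ (projector_onto_bc g eL)).
rewrite -(map_face g) -!map_mxM; apply/rowP => l; rewrite !mxE.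
apply/eqP; rewrite -subr_eq0 -rmorphB; apply/eqP/I0.
by exists p, i, v, l, e; split; rewrite // !mxE.
Qed.

Lemma Grsimp_determinantal : determinantal_subscheme (@Grsimp k s K).
Proof.
split; first exact: Grsimp_closed.
(* The relevant pairs (p+1, i) form a finite type, enumerated to index the intersection. *)
pose face_index := {t : {p : 'I_(dim_n s) & 'I_p.+2} |
  (0 < Kgen s K (tag t).+1)%N}.
pose t (j : 'I_#|{: face_index}|) := val (enum_val j).
exists #|{: face_index}|, (fun j => taut s K (tag (t j)).+1),
  (fun j => tautquo s K (tag (t j))), (fun j => @phi k s K _ (tagged (t j))),
  (fun j => Kgen s K (tag (t j)).+1),
  (fun j => dimC (dim_n s) (tag (t j)) - Kgen s K (tag (t j)))%N, (fun=> 0%N).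
split=> [j | R x].
  have pn := ltn_ord (tag (t j)).
  by split; [exact: taut_vector_bundle | exact: tautquo_vector_bundle |
    exact: phi_bundle_morphism].
rewrite Grsimp_determinantal_locus; split=> [H j | H p i pn Kp].
  by apply: H; [exact: ltn_ord | exact: valP (enum_val j)].
pose t0 : {p : 'I_(dim_n s) & 'I_p.+2} :=
  Tagged (fun p : 'I_(dim_n s) => 'I_p.+2) (i : 'I_(Ordinal pn).+2).
have := H (enum_rank (exist _ t0 Kp : face_index)).
by rewrite /t enum_rankK.
Qed.
End Incidence.

Local Open Scope classical_set_scope.

Theorem proposition8p15 (K : fieldType) (K_infinite : infinite_set [set: K])
    (k : nat) (k_gt0 : 0 < k) (s : 'I_k -> nat) (s_gt0 : forall a, 0 < s a) :
  (forall (p : nat) (i : 'I_p.+2), p.+1 <= dim_n s -> 0 < Kgen s K p.+1 ->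
    [/\ vector_bundle (Kgen s K p.+1) (taut s K p.+1),
        vector_bundle (dimC (dim_n s) p - Kgen s K p) (tautquo s K p) &
        bundle_morphism (@phi k s K p i)]) /\
  (forall (R : comAlgType K) (x : Grs s K R),
    Grsimp s K x <->
    forall (p : nat) (i : 'I_p.+2), p.+1 <= dim_n s -> 0 < Kgen s K p.+1 ->
      zero_scheme (@phi k s K p i) x) /\
  (forall (R : comAlgType K) (x : Grs s K R),
    Grsimp s K x <->
    forall (p : nat) (i : 'I_p.+2), p.+1 <= dim_n s -> 0 < Kgen s K p.+1 ->
      determinantal_locus (@phi k s K p i) 0 x) /\
  determinantal_subscheme (@Grsimp k s K).
Proof.
split=> [p i pn _|]; first split.
- exact: taut_vector_bundle.
- exact: tautquo_vector_bundle.
- exact: phi_bundle_morphism.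
split; first exact: Grsimp_zero_scheme.
by split; [exact: Grsimp_determinantal_locus | exact: Grsimp_determinantal].
Qed.
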